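(* Let $(K,|\cdot|_K)$ be a non-archimedean local field with residue class field $k_K$, let $n \geq 2$ be an integer with $\mathrm{char}\,k_K > n$, and let $a \in \mathbb{N}$. Suppose $(x_1,\dots,x_n), (y_1,\dots,y_n) \in (\mathfrak{o}_K)^n$ satisfy $$|x_1^j + \cdots + x_n^j - y_1^j - \cdots - y_n^j|_K \leq q_K^{-na} \qquad \text{for all } 1 \leq j \leq n.$$ Then there exists a permutation $\sigma$ of $\{1,\dots,n\}$ such that $|x_j - y_{\sigma(j)}|_K \leq q_K^{-a}$ for all $1 \leq j \leq n$.
   Context: A non-archimedean local field $(K,|\cdot|_K)$ is a field $K$ with an absolute value $|\cdot|_K : K \to [0,\infty)$ which is multiplicative, vanishes only at $0$, and satisfies $|x+y|_K \leq \max\{|x|_K,|y|_K\}$, such that $|\cdot|_K$ is non-trivial and discrete (the value group $\{|x|_K : x \in K\setminus\{0\}\}$ is a discrete subgroup of $(0,\infty)$), $K$ is complete, and the residue class field is finite. The ring of integers is $\mathfrak{o}_K := \{x \in K : |x|_K \leq 1\}$, its maximal ideal is $\mathfrak{m}_K := \{x \in K: |x|_K < 1\}$, and the residue class field is $k_K := \mathfrak{o}_K/\mathfrak{m}_K$. A uniformiser $\pi_K$ is a generator of $\mathfrak{m}_K$, and $q_K := |\pi_K|_K^{-1} > 1$. *)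

(* Defs.v *)
From HB Require Import structures.
From mathcomp Require Import all_boot all_order all_algebra.
From mathcomp Require Import ring_quotient.
From mathcomp Require Import all_classical all_reals topology normedtype.

Set Implicit Arguments.
Unset Strict Implicit.
Unset Printing Implicit Defensive.

Import Order.TTheory GRing.Theory Num.Theory.
Import numFieldNormedType.Exports.

Local Open Scope classical_set_scope.
Local Open Scope ring_scope.

Record nonarch_abs (R : realType) (K : fieldType) := NonarchAbs {
  abs_fun :> K -> R;
  abs_ge0 : forall x, 0 <= abs_fun x;
  abs_eq0 : forall x, abs_fun x = 0 <-> x = 0;
  absM : forall x y, abs_fun (x * y) = abs_fun x * abs_fun y;
  abs_ultra : forall x y, abs_fun (x + y) <= Num.max (abs_fun x) (abs_fun y) }.

Section NonarchAbs.
Variables (R : realType) (K : fieldType) (v : nonarch_abs R K).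

Lemma abs0 : v 0 = 0.
Proof. exact/abs_eq0. Qed.

Lemma abs1 : v 1 = 1.
Proof.
have v1 : v 1 != 0 by apply/eqP => /abs_eq0 /eqP; rewrite oner_eq0.
by apply: (mulfI v1); rewrite -absM !mulr1.
Qed.

Lemma absN x : v (- x) = v x.
Proof.
have vN1 : v (- 1) = 1.
  have /eqP : v (- 1) ^+ 2 = 1 by rewrite expr2 -absM mulrNN mulr1 abs1.
  by rewrite sqrp_eq1 ?abs_ge0 // => /eqP.
by rewrite -mulN1r absM vN1 mul1r.
Qed.

Lemma absB x y : v (x - y) <= Num.max (v x) (v y).
Proof. by rewrite -(absN y) abs_ultra. Qed.

Record int_ring := IntRing { int_val :> K; int_valP : v int_val <= 1 }.

Definition int_pred : pred K := fun x => v x <= 1.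

HB.instance Definition _ := [isSub of int_ring for int_val].
HB.instance Definition _ := [Choice of int_ring by <:].

Lemma int_pred_subring : subring_closed int_pred.
Proof.
split; rewrite /in_mem /= /int_pred; first by rewrite abs1.
- move=> x y; rewrite /in_mem /= => vx vy.
  by rewrite (le_trans (absB _ _)) // ge_max vx.
- move=> x y; rewrite /in_mem /= => vx vy.
  by rewrite absM mulr_ile1 ?abs_ge0.
Qed.

HB.instance Definition _ := GRing.isSubringClosed.Build K int_pred
  int_pred_subring.
HB.instance Definition _ :=
  GRing.SubChoice_isSubComNzRing.Build K int_pred int_ring int_pred_subring.

Definition max_ideal : {pred int_ring} := fun x => v x < 1.

Lemma max_ideal_closed : idealr_closed max_ideal.
Proof.
split; rewrite ?inE /in_mem /= /max_ideal.
- by rewrite abs0.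
- by rewrite abs1 ltxx.
- move=> a x y vx vy /=; apply: le_lt_trans (abs_ultra _ _ _) _.
  rewrite gt_max; apply/andP; split=> //=.
  rewrite absM; apply: le_lt_trans (vx : v x < 1).
  by rewrite ler_piMl ?abs_ge0 ?int_valP.
Qed.

HB.instance Definition _ :=
  isIdealr.Build int_ring max_ideal max_ideal_closed.

Definition residue_field := {ideal_quot max_ideal}.

Local Open Scope quotient_scope.

(* The inverse is chosen classically; it exists because the elements of
   absolute value 1 are the units of [int_ring]. *)
Definition residue_inv (x : residue_field) : residue_field :=
  xget 0 [set y | y * x = 1].

Lemma residue_mulVf (x : residue_field) : x != 0 -> residue_inv x * x = 1.
Proof.
move=> x0; suff ey : exists y : residue_field, y * x = 1.
  by rewrite /residue_inv; case: xgetP => [y _ //|]; case: ey => y /[swap] /(_ y).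
have [r rx] : exists r : int_ring, \pi_residue_field r = x.
  by exists (repr x); rewrite reprK.
have nm : r \notin max_ideal.
  by apply: contra x0; rewrite -[r]subr0 Quotient.idealrBE rx pi_zeror.
have vr : v r = 1.
  by apply/eqP; rewrite eq_le int_valP leNgt.
have r0 : int_val r != 0.
  by apply/eqP => r0; move: vr; rewrite r0 abs0 => /esym /eqP; rewrite oner_eq0.
have vV : v (int_val r)^-1 <= 1.
  have : v (int_val r)^-1 * v r = 1 by rewrite -absM mulVf ?abs1.
  by rewrite vr mulr1 => ->.
exists (\pi_residue_field (IntRing vV)).
rewrite -rx -[LHS]rmorphM -[RHS](rmorph1 \pi_residue_field).
by congr (\pi_residue_field _); apply: val_inj; rewrite /= mulVf.
Qed.

Lemma residue_inv0 : residue_inv 0 = 0.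
Proof.
rewrite /residue_inv; case: xgetP => // y _ /= /eqP.
by rewrite mulr0 eq_sym oner_eq0.
Qed.

HB.instance Definition _ := GRing.ComNzRing.on residue_field.
HB.instance Definition _ :=
  GRing.ComNzRing_isField.Build residue_field residue_mulVf residue_inv0.

Local Close Scope quotient_scope.

(* [pi] generates [max_ideal] as an ideal of [int_ring]. *)
Definition uniformiser (pi : int_ring) :=
  forall x : int_ring, x \in max_ideal <-> exists y, x = pi * y.

Definition value_group : set R := [set v x | x in [set x | x != 0]].

(* [isolated A] consists of the points of [A] that are open in the subspace
   topology of [A], so [abs_discrete] says that the value group is discrete. *)
Record local_field : Prop := LocalField {
  abs_nontrivial : exists2 x : K, x != 0 & v x != 1;
  abs_discrete : value_group `<=` isolated value_group;
  abs_complete : forall u : nat -> K,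
    (forall e : R, 0 < e -> \forall m & k \near \oo, v (u m - u k) < e) ->
    exists l : K, v (u m - l) @[m --> \oo] --> (0 : R);
  residue_finite : finite_set [set: residue_field] }.

End NonarchAbs.

(* Main.v *)
Require Import Defs.
From mathcomp Require Import all_boot all_order all_fingroup all_algebra.
From mathcomp Require Import ring lra.
From mathcomp Require Import all_classical all_reals.

(** Put [r := |pi|^a]. The claim says that every closed ball of radius [r]
    contains as many of the [x i] as of the [y i]: lying within distance [r]
    is an equivalence relation in an ultrametric space, and two families with
    the same number of members in each class can be matched class by class
    ([ball_matching]).

    So fix a center [c]. By the binomial theorem the power sums of the
    translates [x i - c] and [y i - c] still differ by at most [r ^ n]
    ([psum_shift_close]), hence one may take [c = 0]. Newton's identities
    express the coefficients of [\prod_i (1 - x i T)] through the power sums,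
    the only divisions being by integers in [1, n]; these are units, because
    [n] is smaller than the residue characteristic. Therefore the products
    attached to [x] and to [y] have coefficients [r ^ n]-close to each other
    ([recip_close]).

    The number of [x i] outside the ball is visible in these coefficients, as
    in the theory of Newton polygons. The Gauss norm [max_m |P_m| / r ^ m] is
    multiplicative, a factor [1 - z T] has norm [max(1, |z| / r)], and the
    first index at which the norm of the product is attained is the number of
    [i] with [|x i| > r] ([gauss_first_recip]). Unless that number is zero the
    norm exceeds [1]; a perturbation of size at most [r ^ n] of coefficients of
    index at most [n] has norm at most [1], so that it changes neither the norm
    nor the index at which it is first attained ([count_far_eq]). If the number
    is zero for [x] but not for [y], exchange [x] and [y]. *)

Set Implicit Arguments.
Unset Strict Implicit.
Unset Printing Implicit Defensive.

Import Order.TTheory GRing.Theory Num.Theory.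

Local Open Scope ring_scope.

(** * Power sums and Newton's identities *)

Section PowerSums.
Variable A : comNzRingType.
Implicit Types (s : seq A) (c : A).

Definition psum s j : A := \sum_(z <- s) z ^+ j.

(** The reciprocal of the polynomial with roots [s]: its coefficients are the
    signed elementary symmetric functions of [s], in increasing degree. *)
Definition recip s : {poly A} := \prod_(z <- s) (1 - z *: 'X).

Lemma psum0 s : psum s 0 = (size s)%:R.
Proof.
rewrite /psum; elim: s => [|z s IH]; first by rewrite big_nil.
by rewrite big_cons IH expr0 -natr1 addrC.
Qed.

Lemma recip_cons z s : recip (z :: s) = (1 - z *: 'X) * recip s.
Proof. exact: big_cons. Qed.

Lemma recip_coef0 s : (recip s)`_0 = 1.
Proof.
elim: s => [|z s IH]; first by rewrite /recip big_nil coef1.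
by rewrite recip_cons -!horner_coef0 !hornerE horner_coef0 IH; ring.
Qed.

Lemma coef_recip_cons z s m :
  (recip (z :: s))`_m.+1 = (recip s)`_m.+1 - z * (recip s)`_m.
Proof. by rewrite recip_cons mulrBl mul1r coefB -scalerAl coefZ coefXM. Qed.

Lemma recip_coef_gt s m : (size s < m)%N -> (recip s)`_m = 0.
Proof.
elim: s m => [|z s IH] [|m] //= sm; first by rewrite /recip big_nil coef1.
by rewrite coef_recip_cons !IH ?mulr0 ?subr0 //; apply: ltnW.
Qed.

(** The logarithmic derivative of [1 - z T] is minus the geometric series
    [\sum_j z ^ j.+1 T ^ j]; summing over [s] gives the generating series of
    the power sums. Working modulo [T ^ N] keeps everything polynomial. *)
Lemma recip_logderiv s N : exists g : {poly A},
  - (recip s)^`() =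
  recip s * \sum_(j < N) psum s j.+1 *: 'X^j + 'X^N * g.
Proof.
elim: s => [|z s [g IH]].
  exists 0; rewrite /recip big_nil derivC big1 => [|j _]; first by ring.
  by rewrite /psum big_nil scale0r.
pose G : {poly A} := \sum_(j < N) z ^+ j.+1 *: 'X^j.
have geom : (1 - z *: 'X) * G = z%:P * (1 - (z ^+ N)%:P * 'X^N).
  have -> : G = z%:P * \sum_(j < N) (z *: 'X) ^+ j.
    rewrite /G mulr_sumr; apply: eq_bigr => j _.
    by rewrite exprZn mul_polyC scalerA exprS.
  have := subrX1 (z *: 'X : {poly A}) N.
  rewrite exprZn -mul_polyC => e.
  rewrite mulrCA; congr (_ * _); apply: oppr_inj.
  by rewrite -mulNr !opprB -e.
have -> : \sum_(j < N) psum (z :: s) j.+1 *: 'X^j =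
    G + \sum_(j < N) psum s j.+1 *: 'X^j.
  rewrite -big_split; apply: eq_bigr => j _ /=.
  by rewrite -scalerDl /psum big_cons.
exists ((1 - z *: 'X) * g + z%:P * (z ^+ N)%:P * recip s).
rewrite recip_cons derivM derivB derivZ derivX derivC.
rewrite mulrAC mulrDr geom.
move: IH; set S := \sum_(j < N) _ => IH.
have {}IH : (recip s)^`() = - (recip s * S + 'X^N * g) by rewrite -IH opprK.
by rewrite IH -!mul_polyC; ring.
Qed.

(** Newton's identities: the coefficient of [T ^ m] in [recip_logderiv]. *)
Lemma newton s m :
  m.+1%:R * (recip s)`_m.+1 =
  - \sum_(j < m.+1) (recip s)`_j * psum s (m - j).+1.
Proof.
have [g /(congr1 (fun P : {poly A} => P`_m))] := recip_logderiv s m.+1.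
rewrite coefN coef_deriv coefD coefXnM ltnSn addr0 coefM => e.
rewrite mulr_natl -[LHS]opprK e; congr (- _); apply: eq_bigr => j _.
congr (_ * _); rewrite -(poly_def m.+1 (fun j => psum s j.+1)) coef_poly.
by rewrite ltnS leq_subr.
Qed.

Lemma psum_shift s c j :
  psum [seq z - c | z <- s] j =
  \sum_(i < j.+1) ((- c) ^+ i *+ 'C(j, i)) * psum s (j - i).
Proof.
rewrite /psum big_map.
under eq_bigr do rewrite exprDn.
rewrite exchange_big; apply: eq_bigr => i _ /=.
by rewrite mulr_sumr; apply: eq_bigr => z _; rewrite mulrnAl mulrC.
Qed.

End PowerSums.

(** * Ultrametric estimates in the ring of integers *)

Section Ultrametric.
Variables (R : realType) (K : fieldType) (v : nonarch_abs R K).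
Local Notation O := (int_ring v).
Local Notation far r := (fun z : O => r < v z).
Local Notation near r c := (fun z : O => v (z - c : O) <= r).

Lemma abs_addr_le (x y : K) (B : R) : v x <= B -> v y <= B -> v (x + y) <= B.
Proof. by move=> xB yB; rewrite (le_trans (abs_ultra _ _ _)) // ge_max xB. Qed.

Lemma abs_addr_lt (x y : K) (B : R) : v x < B -> v y < B -> v (x + y) < B.
Proof.
by move=> xB yB; rewrite (le_lt_trans (abs_ultra _ _ _)) // gt_max xB.
Qed.

(** Strict domination: were [x + y] smaller than [x], then so would be
    [x = (x + y) - y]. *)
Lemma abs_addr_eq (x y : K) : v y < v x -> v (x + y) = v x.
Proof.
move=> yx; apply/eqP; rewrite eq_le abs_addr_le ?(ltW yx) //= leNgt.
apply/negP => lt; have := @abs_addr_lt (x + y) (- y) _ lt.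
by rewrite absN => /(_ yx); rewrite addrK ltxx.
Qed.

Lemma abs_subC (x y : K) : v (x - y) = v (y - x).
Proof. by rewrite -absN opprB. Qed.

Lemma abs_sum_le I (l : seq I) (P : pred I) (F : I -> O) (B : R) :
  0 <= B -> (forall i, P i -> v (F i) <= B) ->
  v (\sum_(i <- l | P i) F i : O) <= B.
Proof.
move=> B0 FB; elim/big_ind : _ => //; first by rewrite abs0.
by move=> x y; apply: abs_addr_le.
Qed.

Lemma abs_mulr_le (x y : O) (B : R) : v y <= B -> v (x * y : O) <= B.
Proof.
move=> yB; rewrite absM; apply: le_trans yB.
by rewrite ler_piMl ?abs_ge0 ?int_valP.
Qed.

(** An integer of absolute value less than [1] vanishes in the residue field,
    hence is a multiple of its characteristic. *)
Lemma abs_natr_unit p n : p \in [pchar (residue_field v)] ->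
  (0 < n < p)%N -> v (n%:R : O) = 1.
Proof.
move=> hp /andP[n0 np]; apply/eqP; rewrite eq_le int_valP leNgt /=.
apply/negP => ni; have : (n%:R : O) \in @max_ideal _ _ v by [].
rewrite -[n%:R]subr0 Quotient.idealrBE.
rewrite [X in _ == X]rmorph0 rmorph_nat -(dvdn_pcharf hp).
by move=> /(dvdn_leq n0); rewrite leqNgt np.
Qed.

(** If [pi] were zero, the maximal ideal would be zero and the absolute value
    trivial: for [z] with [|z| > 1] the inverse of [z] lies in the ideal. *)
Lemma uniformiser_abs_gt0 (pi : O) :
  local_field v -> uniformiser pi -> 0 < v pi.
Proof.
move=> hK hpi; rewrite lt_neqAle abs_ge0 andbT eq_sym.
apply/eqP => /abs_eq0 pi0.
have small (z : K) : z != 0 -> ~~ (v z < 1).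
  apply: contra_neqN => z1.
  have [+ _] := hpi (IntRing (ltW z1)).
  by move=> /(_ z1)[y /(congr1 (@int_val _ _ v))] /= ->; rewrite pi0 mul0r.
have [z z0] := abs_nontrivial hK.
rewrite neq_lt (negPf (small z z0)) /= => z1.
have /negP[] := small z^-1 (invr_neq0 z0).
have := absM v z z^-1; rewrite mulfV // abs1.
have := abs_ge0 v z^-1; nra.
Qed.

(** * From close power sums to close coefficients *)

Section Close.
Variables (s t : seq O) (n : nat) (B : R).
Hypothesis B0 : 0 <= B.

Lemma psum_shift_close (c : O) :
  (forall j, (j <= n)%N -> v (psum s j - psum t j : O) <= B) ->
  forall j, (j <= n)%N ->
  v (psum [seq z - c | z <- s] j - psum [seq z - c | z <- t] j : O) <= B.
Proof.
move=> st j jn; rewrite !psum_shift -sumrB.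
apply: abs_sum_le => // i _; rewrite -mulrBr.
by apply/abs_mulr_le/st; rewrite (leq_trans (leq_subr _ _)).
Qed.

(** By Newton's identities [(m + 1) (P_{m + 1} - Q_{m + 1})] is a sum of
    differences of products whose factors are integral and pairwise close. *)
Lemma recip_close :
  (forall j, (0 < j <= n)%N -> v (j%:R : O) = 1) ->
  (forall j, (j <= n)%N -> v (psum s j - psum t j : O) <= B) ->
  forall m, (m <= n)%N -> v ((recip s)`_m - (recip t)`_m : O) <= B.
Proof.
move=> unit st; elim/ltn_ind => -[|m] IH mn.
  by rewrite !recip_coef0 subrr abs0.
rewrite -[leLHS]mul1r -(unit m.+1) // -absM.
rewrite -[X in v X]/(int_val (m.+1%:R * ((recip s)`_m.+1 - (recip t)`_m.+1))).
rewrite mulrBr !newton -opprD -[X in v X]/(- int_val _) absN -sumrB.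
apply: abs_sum_le => // j _.
have -> : (recip s)`_j * psum s (m - j).+1 - (recip t)`_j * psum t (m - j).+1
  = (recip s)`_j * (psum s (m - j).+1 - psum t (m - j).+1)
    + psum t (m - j).+1 * ((recip s)`_j - (recip t)`_j) by ring.
apply: abs_addr_le; apply: abs_mulr_le.
  by apply: st; rewrite (leq_ltn_trans (leq_subr _ _)).
by apply: IH; rewrite ?(leq_trans (ltnW (ltn_ord j))).
Qed.

End Close.

(** * Counting large elements with the Gauss norm *)

Section GaussNorm.
Variable r : R.
Hypothesis r0 : 0 < r.

(** The Gauss norm of [P] for the radius [1 / r] is [A], and [k] is the first
    index at which it is attained; this is the abscissa of a vertex of the
    Newton polygon of [P]. *)
Definition gauss_first (P : {poly O}) (A : R) (k : nat) :=
  [/\ v P`_k = A * r ^+ k,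
      forall m, v P`_m <= A * r ^+ m
    & forall m, (m < k)%N -> v P`_m < A * r ^+ m].

Lemma gauss_first_inj P A A' k k' :
  gauss_first P A k -> gauss_first P A' k' -> k = k'.
Proof.
have le B B' i i' : gauss_first P B i -> gauss_first P B' i' -> (B' <= B).
  move=> [_ Bm _] [Bi' _ _]; have := Bm i'; rewrite Bi' ler_pM2r //.
  exact: exprn_gt0.
move=> g g'; have AA : A = A'.
  by apply/eqP; rewrite eq_le (le _ _ _ _ g g') (le _ _ _ _ g' g).
move: g g' => [gk _ lk] [gk' _ lk']; rewrite AA in gk lk.
case: (ltngtP k k') => // kk.
  by have := lk' _ kk; rewrite gk ltxx.
by have := lk _ kk; rewrite gk' ltxx.
Qed.

Lemma gauss_first_close (P Q : {poly O}) A k : gauss_first P A k ->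
  (forall m, v (P`_m - Q`_m : O) < A * r ^+ m) -> gauss_first Q A k.
Proof.
move=> [Pk Pm Plt] PQ.
have QE m : int_val Q`_m = int_val P`_m + - int_val (P`_m - Q`_m).
  by rewrite /= opprB addrC subrK.
split=> [|m|m mk]; rewrite QE.
- by rewrite abs_addr_eq // absN Pk.
- by apply: abs_addr_le => //; rewrite absN ltW.
- by apply: abs_addr_lt; [apply: Plt|rewrite absN].
Qed.

(** A factor [1 - z T] has its dominant term at index [1] when [|z| > r], with
    norm [|z| / r], and at index [0] with norm [1] otherwise, where first
    positions decide ties; indices add and norms multiply. The bounds on [A]
    record that each factor with [|z| > r] makes the norm strictly larger. *)
Lemma gauss_first_recip (s : seq O) : exists A : R,
  [/\ 1 <= A, (0 < count (far r) s)%N -> 1 < A &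
  gauss_first (recip s) A (count (far r) s)].
Proof.
elim: s => [|z s [A [A1 A2 [Ek Em El]]]] /=.
  exists 1; split=> //; rewrite /recip big_nil; split=> //.
    by rewrite coef1 abs1 mul1r.
  by case=> [|m]; rewrite coef1 ?abs1 ?abs0 ?mul1r // exprn_ge0 ?ltW.
have A0 : 0 < A by apply: lt_le_trans A1.
have rm m : 0 < r ^+ m by apply: exprn_gt0.
have mulz m : v (- (z * (recip s)`_m) : O) = v z * v (recip s)`_m.
  by rewrite -absM; exact: absN.
case: (ltP r (v z)) => rz /=.
  have ratio : 1 < v z / r by rewrite ltr_pdivlMr // mul1r.
  have A' m : A * (v z / r) * r ^+ m.+1 = v z * (A * r ^+ m).
    by rewrite exprS; field; apply: lt0r_neq0.
  (* The new norm is larger, so only the terms [- z P_m] can attain it. *)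
  have up m : v (recip s)`_m < A * (v z / r) * r ^+ m.
    by apply: le_lt_trans (Em m) _; rewrite ltr_pM2r // ltr_pMr.
  have z0 : 0 < v z by apply: lt_trans rz.
  have big : 1 < A * (v z / r).
    by apply: (lt_le_trans ratio); rewrite ler_peMl // ltW // divr_gt0.
  exists (A * (v z / r)); split=> //; first exact: ltW.
  rewrite add1n; split=> [|[|m]|[|m] mk].
  - rewrite coef_recip_cons addrC A' -Ek -mulz.
    apply: abs_addr_eq; rewrite mulz Ek -A'; exact: up.
  - by rewrite recip_coef0 abs1 mulr1 ltW.
  - rewrite coef_recip_cons; apply: abs_addr_le; first exact/ltW/up.
    by rewrite mulz A' ler_pM2l.
  - by rewrite recip_coef0 abs1 mulr1.
  - rewrite coef_recip_cons; apply: abs_addr_lt; first exact: up.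
    by rewrite mulz A' ltr_pM2l // El.
exists A; rewrite add0n; split=> //.
have A' m : A * r ^+ m.+1 = r * (A * r ^+ m) by rewrite exprS mulrCA.
have low m : (m < count (far r) s)%N ->
    v z * v (recip s)`_m < A * r ^+ m.+1.
  move=> mk; rewrite A' (@le_lt_trans _ _ (r * v (recip s)`_m)) //.
    by rewrite ler_wpM2r ?abs_ge0.
  by rewrite ltr_pM2l // El.
split=> [|[|m]|[|m] mk].
- move: Ek low; case: (count _ s) => [|k] Ek low.
    by rewrite -Ek !recip_coef0.
  by rewrite coef_recip_cons -Ek abs_addr_eq // mulz Ek low.
- by rewrite recip_coef0 abs1 mulr1.
- rewrite coef_recip_cons; apply: abs_addr_le; first exact: Em.
  by rewrite mulz A' ler_pM ?abs_ge0.
- by rewrite recip_coef0 -(recip_coef0 s) El.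
- rewrite coef_recip_cons; apply: abs_addr_lt; first exact: El.
  by rewrite mulz low // ltnW.
Qed.

(** When some element of [s] exceeds [r], the norm of [recip s] is larger than
    [1], and the difference of the two polynomials has norm at most [1] since
    [r ^ size s <= r ^ m]. So the first dominant index is the same for [t]. If
    none does, the roles of [s] and [t] are exchanged. *)
Lemma count_far_eq (s t : seq O) : r <= 1 -> size s = size t ->
  (forall m, (m <= size s)%N ->
    v ((recip s)`_m - (recip t)`_m : O) <= r ^+ size s) ->
  count (far r) s = count (far r) t.
Proof.
move=> r1.
have first_eq (u w : seq O) : size u = size w ->
    (forall m, (m <= size u)%N ->
      v ((recip u)`_m - (recip w)`_m : O) <= r ^+ size u) ->
    (0 < count (far r) u)%N ->
    count (far r) u = count (far r) w.
  move=> uw close u0; have [A [A1 /(_ u0) A2 gu]] := gauss_first_recip u.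
  have [A' [_ _ gw]] := gauss_first_recip w.
  apply: gauss_first_inj gw; apply: gauss_first_close gu _ => m.
  have [mu|um] := leqP m (size u).
    apply: le_lt_trans (close _ mu) _.
    apply: (@le_lt_trans _ _ (r ^+ m)); last by rewrite ltr_pMl ?exprn_gt0.
    by rewrite ler_wiXn2l // ltW.
  rewrite !recip_coef_gt -?uw // subrr abs0 mulr_gt0 ?exprn_gt0 //.
  exact: lt_trans A2.
move=> st close.
have [s0|] := posnP (count (far r) s); last exact: first_eq.
have [t0|t0] := posnP (count (far r) t); first by rewrite s0 t0.
apply/esym/first_eq => //; rewrite -st => m ms.
by apply: le_trans (close m ms); rewrite le_eqVlt abs_subC eqxx.
Qed.

End GaussNorm.

(** * Counting in balls, and the matching *)

Lemma count_near_eq (s t : seq O) (r : R) (c : O) : 0 < r -> r <= 1 ->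
  size s = size t ->
  (forall j, (0 < j <= size s)%N -> v (j%:R : O) = 1) ->
  (forall j, (0 < j <= size s)%N ->
    v (psum s j - psum t j : O) <= r ^+ size s) ->
  count (near r c) s = count (near r c) t.
Proof.
move=> r0 r1 st unit close.
have B0 : 0 <= r ^+ size s by rewrite exprn_ge0 ?ltW.
(* Translating the power sums brings in the one of exponent [0], the size. *)
have close0 j : (j <= size s)%N -> v (psum s j - psum t j : O) <= r ^+ size s.
  case: j => [_|j js]; last exact: close.
  by rewrite !psum0 -st subrr abs0.
pose shift (u : seq O) := [seq z - c | z <- u].
have near_far (u : seq O) :
    count (near r c) u = (size u - count (far r) (shift u))%N.
  rewrite count_map -(count_predC (near r c) u).
  rewrite (@eq_count _ (preim _ _) (predC (near r c))) ?addnK // => z /=.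
  by rewrite ltNge.
rewrite !near_far st (@count_far_eq r r0 _ (shift t)) //.
  by rewrite !size_map.
rewrite size_map; apply: recip_close => //.
exact: psum_shift_close.
Qed.

(** A canonical choice of a point in each ball of radius [r] replaces nearness
    by equality of chosen points; the counting hypothesis then says that the
    tuples of chosen points are permutations of each other. *)
Lemma ball_matching n (x y : n.-tuple O) (r : R) : 0 <= r ->
  (forall c : O, count (near r c) x = count (near r c) y) ->
  exists s : 'S_n, forall j, v (tnth x j - tnth y (s j) : O) <= r.
Proof.
move=> r0 xy.
pose close (u z : O) := v (z - u : O) <= r.
have closexx u : close u u by rewrite /close subrr abs0.
have close_sym u z : close u z = close z u by rewrite /close abs_subC.
have close_trans u z w : close u z -> close z w -> close u w.
  move=> uz zw; rewrite /close.
  by rewrite -[w - u](subrKA z) addrC; apply: abs_addr_le.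
pose rep u := choose (close u) u.
have repP u : close u (rep u) by apply: chooseP.
have repE u z : (rep z == rep u) = close u z.
  apply/eqP/idP => [e|uz].
    apply: close_trans (repP u) _; rewrite -e close_sym; exact: repP.
  rewrite /rep (@eq_choose _ (close z) (close u)).
    by apply: choose_id.
  move=> w; apply/idP/idP => [|uw]; first exact: close_trans.
  by apply: close_trans uw; rewrite close_sym.
have pe : perm_eq (map_tuple rep x) (map_tuple rep y).
  apply/allP => c; rewrite mem_cat /= => cxy; apply/eqP.
  have [u ->] : exists u, c = rep u.
    by case/orP: cxy => /mapP[u _ ->]; exists u.
  rewrite !count_map; under eq_count do rewrite /= repE.
  by rewrite xy; apply: eq_count => z /=; rewrite repE.
have /tuple_permP[s /val_inj e] := pe.
exists s => j; rewrite -/(close _ _) -repE eq_sym.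
have := congr1 (fun w : n.-tuple O => tnth w j) e.
by rewrite tnth_mktuple !tnth_map => ->.
Qed.

End Ultrametric.

Theorem proposition1p2 (R : realType) (K : fieldType) (v : nonarch_abs R K)
    (hK : local_field v) (pi : int_ring v) (hpi : uniformiser pi)
    (n : nat) (hn : (2 <= n)%N)
    (p : nat) (hp : p \in [pchar (residue_field v)]) (hnp : (n < p)%N)
    (a : nat) (x y : 'I_n -> int_ring v) :
  let q := (v pi)^-1 in
  (forall j : nat, (1 <= j <= n)%N ->
     v (\sum_(i < n) x i ^+ j - \sum_(i < n) y i ^+ j) <= q ^- (n * a)) ->
  exists s : 'S_n, forall j : 'I_n, v (x j - y (s j)) <= q ^- a.
Proof.
move=> q close.
have pi0 := uniformiser_abs_gt0 hK hpi.
pose X := [tuple x i | i < n]; pose Y := [tuple y i | i < n].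
have qE m : q ^- m = v pi ^+ m by rewrite /q exprVn invrK.
have [||s sP] := @ball_matching _ _ v n X Y (v pi ^+ a).
- by rewrite exprn_ge0 // ltW.
- move=> c; apply: count_near_eq; rewrite ?size_tuple //.
  + exact: exprn_gt0.
  + by rewrite exprn_ile1 ?abs_ge0 ?int_valP.
  + move=> j /andP[j0 jn]; apply: (abs_natr_unit hp).
    by rewrite j0 (leq_ltn_trans jn).
  + move=> j /close; rewrite qE -exprM mulnC /psum !big_tuple.
    under eq_bigr do rewrite -[x _](tnth_mktuple x).
    under [X in _ - X]eq_bigr do rewrite -[y _](tnth_mktuple y).
    by [].
by exists s => j; rewrite qE; have := sP j; rewrite !tnth_mktuple.
Qed.
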